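(* Let $k\ge 3$ and $N\ge 3$ be integers, and let $\phi: SO(k)\to SO(N)$ be a continuous homomorphism, i.e. a representation of $SO(k)$ on $\mathbb{R}^N$. Assume that the representation $\phi$ has no one-dimensional invariant subspaces, i.e. there is no one-dimensional linear subspace $L\subseteq\mathbb{R}^N$ with $\phi(g)L=L$ for all $g\in SO(k)$. Then the subgroup of $SO(N)$ generated by the elements $E_\sigma^{-1}\phi(g)E_\sigma$, with $g\in SO(k)$ and $\sigma\in S_N$, is all of $SO(N)$. In particular, if $\sigma_0\in S_N$ is a fixed permutation of sign $-1$, then the subgroup of $O(N)$ generated by $$\{E_{\sigma_0}\}\cup\{E_\sigma^{-1}\phi(g)E_\sigma:\ \sigma\in S_N,\ g\in SO(k)\}$$ is all of $O(N)$.
   Context: $S_N$ denotes the symmetric group on $N$ letters and, for $\sigma\in S_N$, $E_\sigma$ denotes the $N\times N$ permutation matrix corresponding to $\sigma$. $O(N)$ and $SO(N)$ are the real orthogonal and special orthogonal groups. ''Generated'' is meant in the abstract group sense (no closure is taken). *)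

(* Defs.v *)
From HB Require Import structures.
From mathcomp Require Import all_boot all_order all_algebra all_fingroup.
From mathcomp Require Import all_classical all_reals all_analysis.

Set Implicit Arguments.
Unset Strict Implicit.
Unset Printing Implicit Defensive.

Import GRing.Theory Num.Theory numFieldNormedType.Exports.

Local Open Scope classical_set_scope.
Local Open Scope ring_scope.

Definition orthogonal_group (R : realType) (n : nat) : set 'M[R]_n :=
  [set A | A^T *m A = 1%:M].

Definition special_orthogonal_group (R : realType) (n : nat) : set 'M[R]_n :=
  [set A | orthogonal_group A /\ \det A = 1].

Arguments orthogonal_group : clear implicits.
Arguments special_orthogonal_group : clear implicits.

Definition matrix_subgroup (R : realType) (n : nat) (H : set 'M[R]_n) : Prop :=
  [/\ H `<=` [set A | A \in unitmx],
      H 1%:M,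
      forall A B, H A -> H B -> H (A *m B)
    & forall A, H A -> H (invmx A)].

(* Generated inside GL_n(R), with no closure taken; for S contained in O(n) or
   SO(n) this is also the subgroup of O(n) or SO(n) generated by S. *)
Definition subgroup_generated (R : realType) (n : nat) (S : set 'M[R]_n) :
  set 'M[R]_n := smallest (@matrix_subgroup R n) S.

(* A homomorphism from SO(k) to SO(n) is given by a function on all matrices
   of which only the values on SO(k) are constrained or used; continuity is
   with respect to the subspace topology of SO(k). *)
Definition continuous_SO_hom (R : realType) (k n : nat)
    (phi : 'M[R]_k -> 'M[R]_n) : Prop :=
  let SOk := special_orthogonal_group R k in
  [/\ forall g, SOk g -> special_orthogonal_group R n (phi g),
      forall g h, SOk g -> SOk h -> phi (g *m h) = phi g *m phi h
    & {within SOk, continuous phi}].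

Definition SO_invariant (R : realType) (k n : nat) (phi : 'M[R]_k -> 'M[R]_n)
    (L : {vspace 'cV[R]_n}) : Prop :=
  forall g, special_orthogonal_group R k g ->
    (linfun (mulmx (phi g) : 'cV[R]_n -> 'cV[R]_n) @: L)%VS = L.

(* [perm_mx s] sends the column basis vector e_(s i) to e_i, so it is the
   inverse of the matrix sending e_i to e_(s i). As s runs over the whole
   symmetric group, both conventions yield the same set. *)
Definition permutation_conjugates (R : realType) (k n : nat)
    (phi : 'M[R]_k -> 'M[R]_n) : set 'M[R]_n :=
  [set A | exists s : 'S_n, exists2 g, special_orthogonal_group R k g &
     A = invmx (perm_mx s) *m phi g *m perm_mx s].

(* Main.v *)
Require Import Defs.
From HB Require Import structures.
From mathcomp Require Import all_boot all_order all_algebra all_fingroup.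
From mathcomp Require Import all_classical all_reals all_analysis.
From mathcomp Require Import ring lra zify.

Set Implicit Arguments.
Unset Strict Implicit.
Unset Printing Implicit Defensive.

Import Order.TTheory GRing.Theory Num.Theory numFieldNormedType.Exports.

Local Open Scope classical_set_scope.
Local Open Scope ring_scope.

(** Let G be the group generated by the conjugates.  The idea is Lie theoretic:
    the Lie algebra of G is a subspace of so(N) that is stable under S_N, and
    so(N), the exterior square of the permutation representation, has few such
    subspaces; they are ruled out because the image of phi does not fix the
    line spanned by the all-ones vector 1.  Everything below is a hands-on
    version of this argument, in which the tangent directions of the abstract
    group G are the velocities at 0 of curves that stay in G.

    - Plane rotations generate SO(k), by Givens elimination
      ([SO_sub_of_plane_rot]).  Hence, if phi of every plane rotation fixed 1,
      then the line spanned by 1 would be invariant ([fixed_vector_line]).  So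
      some one-parameter group h(t) = phi(rotation by t) moves 1.
    - A continuous one-parameter group is differentiable
      ([oneparam_generator]); let A be the velocity of h at 0.  It is
      skew-symmetric, and A 1 <> 0 because h moves 1 ([oneparam_fix]).
    - All simultaneous row and column permutations of A are tangent to G.
      If row m of A has a nonzero sum, the average of A over the permutations
      that send i to m is a nonzero multiple of e_i 1^T - 1 e_i^T
      ([average_stabilizer]).
    - The bracket of two such matrices is, up to matrices of the same kind,
      -N times e_i e_j^T - e_j e_i^T ([wedge_ones_bracket]).  Brackets of
      tangent directions are limits of tangent directions
      ([tangent_bracket]), so all the e_i e_j^T - e_j e_i^T, which span so(N),
      are approximated by tangent directions of G ([wedge_approx]).
    - Multiplying curves in G with these velocities and a symmetric factor
      gives a map from N x N matrices to themselves whose differential at 0 is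
      close to the identity.  By the contraction principle it covers a
      neighbourhood of the identity matrix; the symmetric factor of an
      orthogonal value is trivial, so G contains all orthogonal matrices near
      the identity ([subgroup_contains_neighbourhood]).
    - A rotation by t is the m-th power of the rotation by t / m, so G contains
      every plane rotation, hence SO(N) ([subgroup_contains_SO]).

    For O(N), an odd permutation matrix has determinant -1 and SO(N) has
    index 2. *)

(** * Orthogonal groups and generated subgroups *)

Section MatrixGroups.
Variables (R : realType) (n : nat).

Lemma orthogonal_invmx (B : 'M[R]_n) : orthogonal_group R n B -> invmx B = B^T.
Proof.
rewrite /orthogonal_group/= => oB.
have uB := (mulmx1_unit oB).2.
by rewrite -[LHS]mul1mx -oB mulmxK.
Qed.

Lemma det_orthogonal (M : 'M[R]_n) : orthogonal_group R n M -> \det M ^+ 2 = 1.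
Proof. by move=> /(congr1 determinant); rewrite det_mulmx det_tr det1. Qed.

Lemma orthogonal_group_subgroup : matrix_subgroup (orthogonal_group R n).
Proof.
split=> [A oA||A B oA oB|A oA].
- exact: (mulmx1_unit oA).2.
- by rewrite /orthogonal_group/= trmx1 mulmx1.
- by rewrite /orthogonal_group/= trmx_mul mulmxA -(mulmxA _ A^T) oA mulmx1 oB.
- by rewrite (orthogonal_invmx oA) /orthogonal_group/= trmxK (mulmx1C oA).
Qed.

Lemma SO_subgroup : matrix_subgroup (special_orthogonal_group R n).
Proof.
have [oU o1 oM oV] := orthogonal_group_subgroup.
split=> [A [/oU]//||A B SA SB|A [oA dA]].
- by split; rewrite ?det1.
- case: SA SB => [oA dA] [oB dB].
  by split; [exact: oM|rewrite det_mulmx dA dB mulr1].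
- by split; [exact: oV|rewrite det_inv dA invr1].
Qed.

Lemma subgroup_generated_group (S K : set 'M[R]_n) : matrix_subgroup K ->
  S `<=` K ->
  matrix_subgroup (subgroup_generated S).
Proof.
move=> KG SK; have [KU _ _ _] := KG.
split=> [A hA|M [[_ M1 _ _] _] //|A B hA hB M MG|A hA M MG].
- exact/KU/(hA K).
- by have [[_ _ MM _] _] := MG; apply: MM; [exact: hA|exact: hB].
- by have [[_ _ _ MV] _] := MG; apply: MV; exact: hA.
Qed.

End MatrixGroups.

(** * Plane rotations generate SO(n) *)

Section Rotations.
Variables (R : realType) (n : nat).
Implicit Types (i j a b : 'I_n) (t u : R).

Definition plane_proj i j : 'M[R]_n := delta_mx i i + delta_mx j j.
Definition wedge i j : 'M[R]_n := delta_mx i j - delta_mx j i.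

(** Rotation by the angle t in the oriented plane (e_i, e_j). *)
Definition plane_rot i j t : 'M[R]_n :=
  1%:M + (cos t - 1) *: plane_proj i j + sin t *: wedge j i.

Lemma plane_projM i j : i != j ->
  plane_proj i j *m plane_proj i j = plane_proj i j.
Proof.
move=> ij; rewrite /plane_proj !mulmxDl !mulmxDr !mul_delta_mx_cond !eqxx.
by rewrite (negbTE ij) eq_sym (negbTE ij) !mulr1n !mulr0n addr0 add0r.
Qed.

Lemma plane_proj_wedge i j : i != j ->
  plane_proj i j *m wedge j i = wedge j i.
Proof.
move=> ij; rewrite /plane_proj /wedge !mulmxDl !mulmxBr !mul_delta_mx_cond.
rewrite !eqxx (negbTE ij) eq_sym (negbTE ij) !mulr1n !mulr0n.
by rewrite subr0 add0r addrC.
Qed.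

Lemma wedge_plane_proj i j : i != j ->
  wedge j i *m plane_proj i j = wedge j i.
Proof.
move=> ij; rewrite /plane_proj /wedge !mulmxDr !mulmxBl !mul_delta_mx_cond.
rewrite !eqxx (negbTE ij) eq_sym (negbTE ij) !mulr1n !mulr0n.
by rewrite subr0 add0r.
Qed.

Lemma wedgeM i j : i != j ->
  wedge j i *m wedge j i = - plane_proj i j.
Proof.
move=> ij; rewrite /plane_proj /wedge !mulmxBr !mulmxBl !mul_delta_mx_cond.
rewrite !eqxx (negbTE ij) eq_sym (negbTE ij) !mulr1n !mulr0n.
by rewrite subr0 sub0r opprD addrC.
Qed.

Lemma plane_rotD i j t u : i != j -> plane_rot i j (t + u) =
  plane_rot i j t *m plane_rot i j u.
Proof.
move=> ij; rewrite /plane_rot !(mulmxDl, mulmxDr) !mul1mx mulmx1.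
rewrite -!scalemxAl -!scalemxAr !mulmx1 plane_projM// wedgeM//.
rewrite plane_proj_wedge// wedge_plane_proj// cosD sinD.
by apply/matrixP=> a b; rewrite !mxE; ring.
Qed.

Lemma plane_rot0 i j : plane_rot i j 0 = 1%:M.
Proof. by rewrite /plane_rot cos0 sin0 subrr !scale0r !addr0. Qed.

Lemma tr_plane_rot i j t : (plane_rot i j t)^T = plane_rot i j (- t).
Proof.
rewrite /plane_rot cosN sinN; apply/matrixP=> a b; rewrite !mxE (eq_sym b a).
by rewrite ![(b == _) && _]andbC; ring.
Qed.

Lemma plane_rot_orthogonal i j t : i != j ->
  orthogonal_group R n (plane_rot i j t).
Proof.
by move=> ij; rewrite /orthogonal_group/= tr_plane_rot -plane_rotD// addNr plane_rot0.
Qed.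

Lemma plane_rot_SO i j t : i != j ->
  special_orthogonal_group R n (plane_rot i j t).
Proof.
move=> ij; split; first exact: plane_rot_orthogonal.
by rewrite (splitr t) plane_rotD// det_mulmx -expr2 det_orthogonal//;
  exact: plane_rot_orthogonal.
Qed.

Lemma plane_rot_fix i j t a : a != i -> a != j ->
  plane_rot i j t *m delta_mx a 0 = delta_mx a 0 :> 'cV[R]_n.
Proof.
move=> ai aj; rewrite /plane_rot !mulmxDl mul1mx -!scalemxAl mulmxBl mulmxDl.
rewrite !mul_delta_mx_cond !(eq_sym _ a) (negbTE ai) (negbTE aj) !mulr0n.
by rewrite subr0 !addr0 !scaler0 !addr0.
Qed.

Lemma delta_mul_col i j (v : 'cV[R]_n) a :
  (delta_mx i j *m v) a 0 = (a == i)%:R * v j 0.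
Proof.
rewrite mxE (bigD1 j)//= big1 ?addr0 ?mxE ?eqxx ?andbT// => k kj.
by rewrite mxE (negbTE kj) andbF mul0r.
Qed.

Lemma plane_rot_col i j t (v : 'cV[R]_n) a : (plane_rot i j t *m v) a 0 =
  v a 0 + (a == i)%:R * ((cos t - 1) * v i 0 - sin t * v j 0)
        + (a == j)%:R * (sin t * v i 0 + (cos t - 1) * v j 0).
Proof.
rewrite /plane_rot !mulmxDl mul1mx -!scalemxAl mulmxBl mulmxDl.
have ex (A B C : 'cV[R]_n) k l : (A + k *: B + l *: C) a 0 =
  A a 0 + k * B a 0 + l * C a 0.
  by rewrite !mxE.
have eD (A B : 'cV[R]_n) : (A + B) a 0 = A a 0 + B a 0 by rewrite mxE.
have eB (A B : 'cV[R]_n) : (A - B) a 0 = A a 0 - B a 0 by rewrite !mxE.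
rewrite ex eD eB !delta_mul_col; ring.
Qed.

Lemma polar_angle (c s : R) : c ^+ 2 + s ^+ 2 = 1 ->
  exists t, cos t = c /\ sin t = s.
Proof.
move=> cs1.
have c1 : -1 <= c <= 1.
  by have s0 := sqr_ge0 s; apply/andP; split; nra.
have cK : cos (acos c) = c by rewrite acosK// in_itv.
have sK : sin (acos c) = `|s|.
  by rewrite sin_acos// -cs1 addrAC subrr add0r sqrtr_sqr.
have [s0|s0] := leP 0 s.
  by exists (acos c); rewrite cK sK ger0_norm.
by exists (- acos c); rewrite cosN sinN cK sK ltr0_norm// opprK.
Qed.

(** The new first coordinate is made nonnegative, and not only the second one
    zero, because elimination has to end with a diagonal entry 1 rather than
    -1. *)
Lemma rotate_to_axis (x y : R) :
  exists t, 0 <= cos t * x - sin t * y /\ sin t * x + cos t * y = 0.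
Proof.
pose r := Num.sqrt (x ^+ 2 + y ^+ 2).
have r2 : r ^+ 2 = x ^+ 2 + y ^+ 2 by rewrite sqr_sqrtr// addr_ge0// sqr_ge0.
have [r0|r0] := eqVneq r 0.
  exists 0; rewrite cos0 sin0.
  have x0 := sqr_ge0 x; have y0 := sqr_ge0 y.
  have := r2; rewrite r0 => z.
  have /eqP := z; rewrite expr0n/= eq_sym paddr_eq0// !sqrf_eq0.
  by move=> /andP[/eqP -> /eqP ->]; rewrite !mulr0 subrr addr0.
have [|t [ct st]] := @polar_angle (x / r) (- y / r).
  by rewrite !expr_div_n sqrrN -mulrDl -r2 divff// sqrf_eq0.
exists t; rewrite ct st; split; last by field.
have -> : x / r * x - - y / r * y = r.
  by apply: (mulIf r0); rewrite -expr2 r2; field.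
exact: sqrtr_ge0.
Qed.

End Rotations.

Section Givens.
Variables (R : realType) (n : nat) (H : set 'M[R]_n).
Hypothesis HG : matrix_subgroup H.
Hypothesis Hrot : forall (i j : 'I_n) t, i != j -> H (plane_rot i j t).

Let H1 : H 1%:M. Proof. by case: HG. Qed.
Let HM A B : H A -> H B -> H (A *m B).
Proof. by case: HG => _ _ + _; apply. Qed.
Let HV A : H A -> H (invmx A). Proof. by case: HG => _ _ _; apply. Qed.

Let SO_mul (A B : 'M[R]_n) : special_orthogonal_group R n A ->
  special_orthogonal_group R n B -> special_orthogonal_group R n (A *m B).
Proof. by have [_ _ + _] := SO_subgroup R n; apply. Qed.

(** One Givens step for each index i of [s], rotating in the plane of e_m and
    e_i. Nonnegativity of the pivot needs at least one rotation, whence the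
    condition that [s] be nonempty. *)
Lemma column_elimination (m : 'I_n) (v : 'cV[R]_n) (s : seq 'I_n) :
  all (fun i : 'I_n => (m < i)%N) s ->
  exists Q, [/\ H Q, special_orthogonal_group R n Q,
    forall j : 'I_n, (j < m)%N -> Q *m delta_mx j 0 = delta_mx j 0 :> 'cV_n,
    forall i, i \in s -> (Q *m v) i 0 = 0
    & s != [::] -> 0 <= (Q *m v) m 0].
Proof.
elim: s => [_|i s IH /= /andP[mi ms]].
  have [_ S1 _ _] := SO_subgroup R n.
  by exists 1%:M; split=> // j _; rewrite mul1mx.
have [Q [HQ SQ fQ zQ pQ]] := IH ms.
pose w := Q *m v.
have [t [tm ti]] := rotate_to_axis (w m 0) (w i 0).
have nmi : m != i by rewrite -val_eqE/= neq_ltn mi.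
exists (plane_rot m i t *m Q); split.
- exact/HM/HQ/Hrot.
- exact/SO_mul/SQ/plane_rot_SO.
- move=> j jm; rewrite -mulmxA fQ// plane_rot_fix// -val_eqE/= neq_ltn ?jm//.
  by rewrite (ltn_trans jm mi).
- move=> k; rewrite -mulmxA -/w plane_rot_col inE.
  have [-> _|ki /= ks] := eqVneq k i.
    by rewrite eq_sym (negbTE nmi)/= mul0r addr0 -[RHS]ti; ring.
  have mk : (m < k)%N by apply: (allP ms).
  have /negbTE -> : k != m by rewrite -val_eqE/= neq_ltn mk orbT.
  by rewrite !mul0r !addr0 zQ.
- move=> _; rewrite -mulmxA -/w plane_rot_col eqxx
    (negbTE nmi) mul0r addr0 mul1r.
  by apply: (le_trans tm); rewrite le_eqVlt; apply/orP; left; apply/eqP; ring.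
Qed.

(** Column j of M is e_j, so this entry is the scalar product of columns j and
    m. *)
Lemma SO_entry_dot (M : 'M[R]_n) (j m : 'I_n) : M^T *m M = 1%:M ->
  M *m delta_mx j 0 = delta_mx j 0 :> 'cV_n -> M j m = (j == m)%:R.
Proof.
move=> oM Mj; have : (M^T *m M) j m = (j == m)%:R by rewrite oM mxE.
rewrite mxE => <-; rewrite (bigD1 j)//= big1 ?addr0.
  have := congr1 (fun B : 'cV_n => B j 0) Mj.
  by rewrite -colE !mxE !eqxx => ->; rewrite mul1r.
move=> l lj; have := congr1 (fun B : 'cV_n => B l 0) Mj.
by rewrite -colE !mxE (negbTE lj) => ->; rewrite mul0r.
Qed.

(** Induction on the number d of columns that may differ from those of the
    identity: rotations in planes that avoid the vectors already fixed bring
    the first free column, number m = n - d - 1, to e_m. *)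
Lemma SO_sub_fixing d (M : 'M[R]_n) : special_orthogonal_group R n M ->
  (forall j : 'I_n, (j + d < n)%N ->
    M *m delta_mx j 0 = delta_mx j 0 :> 'cV_n) ->
  H M.
Proof.
elim: d M => [|d IH] M SM fM.
  have -> : M = 1%:M; last exact: H1.
  apply/matrixP=> i j; have := fM j; rewrite addn0 ltn_ord => /(_ isT).
  move=> /(congr1 (fun B : 'cV_n => B i 0)).
  by rewrite -colE !mxE eqxx andbT.
have [dn|nd] := ltnP d n; last first.
  by apply: IH => // j jd; exfalso; lia.
have mn : (n - d.+1 < n)%N by lia.
pose m := Ordinal mn.
pose s := [seq i : 'I_n <- enum 'I_n | (m < i)%N].
have ms : all (fun i : 'I_n => (m < i)%N) s by exact: filter_all.
have [Q [HQ SQ fQ zQ pQ]] := column_elimination (M *m delta_mx m 0) ms.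
have SQM := SO_mul SQ SM.
have invQ : invmx Q *m (Q *m M) = M.
  by rewrite mulKmx// unitmxE (SQ.2) unitr1.
suff HQM : H (Q *m M) by rewrite -invQ; exact/HM/HQM/HV.
have fixlt (j : 'I_n) : (j < m)%N -> Q *m M *m delta_mx j 0 =
  delta_mx j 0 :> 'cV_n.
  by move=> jm; rewrite -mulmxA fM ?fQ//; move: jm; rewrite /m/=; lia.
apply: IH => // j jd; have [jm|mj] := ltnP j m; first exact: fixlt.
have -> : j = m by apply/val_inj => /=; move: mj; rewrite /m/=; lia.
pose A := Q *m M.
have oA : A^T *m A = 1%:M := SQM.1.
have rowlt (i k : 'I_n) : (i < m)%N -> A i k = (i == k)%:R.
  by move=> im; apply: SO_entry_dot => //; exact: fixlt.
have low (i : 'I_n) : (m < i)%N -> A i m = 0.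
  move=> mi; have := zQ i; rewrite mem_filter mi mem_enum => /(_ isT).
  by rewrite mulmxA -colE mxE.
have up (i : 'I_n) : (i < m)%N -> A i m = 0.
  move=> im; rewrite rowlt//.
  by rewrite -val_eqE/= (ltn_eqF im).
have off (i : 'I_n) : i != m -> A i m = 0.
  by rewrite -val_eqE/= neq_ltn => /orP[/up|/low].
have Amm2 : A m m ^+ 2 = 1.
  have : (A^T *m A) m m = 1 by rewrite oA mxE eqxx.
  rewrite mxE (bigD1 m)//= big1 ?addr0 ?mxE -?expr2// => i im.
  by rewrite mxE off// mul0r.
have Amm : A m m = 1.
  (* The pivot squares to 1.  Its sign comes from the last rotation, except
     in the last column, where no rotation is possible: there the matrix is
     diagonal with all other diagonal entries 1, and the sign comes from the
     determinant. *)
  have [s0|sn0] := eqVneq s [::]; last first.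
    have := pQ sn0; rewrite mulmxA -colE mxE -/A => A0.
    by apply/eqP; rewrite -(eqrXn2 (n := 2)) ?Amm2 ?expr1n.
  have ub (i : 'I_n) : (i <= m)%N.
    rewrite leqNgt; apply/negP => mi.
    have : i \in s by rewrite mem_filter mi mem_enum.
    by rewrite s0.
  have dA : A = diag_mx (\row_i (A i i)).
    apply/matrixP => i j'; rewrite [RHS]mxE [X in X *+ _]mxE.
    have [->|ij] := eqVneq i j'; first by rewrite mulr1n.
    rewrite mulr0n; have [im|mi] := ltnP i m.
      by rewrite rowlt// (negbTE ij).
    have im : i = m by apply/val_inj/eqP; rewrite eqn_leq mi ub.
    have jm : (j' < m)%N.
      by rewrite ltn_neqAle ub andbT; apply: contraNN ij => /eqP/val_inj ->;
        rewrite im.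
    have := congr1 (fun B : 'cV_n => B i 0) (fixlt _ jm).
    by rewrite -colE [LHS]mxE [RHS]mxE (negbTE ij).
  have dA1 : \prod_i (\row_i (A i i)) 0 i = 1 by rewrite -det_diag -dA SQM.2.
  rewrite -dA1 (bigD1 m)//= big1 => [|i im]; last first.
    by rewrite [LHS]mxE rowlt ?eqxx// ltn_neqAle ub andbT.
  by rewrite mulr1 [RHS]mxE.
apply/matrixP => i k; rewrite -colE -/A [LHS]mxE [RHS]mxE ord1 eqxx andbT.
by have [->|im] := eqVneq i m; [rewrite Amm|rewrite off].
Qed.

Lemma SO_sub_of_plane_rot : special_orthogonal_group R n `<=` H.
Proof. by move=> M SM; apply: (@SO_sub_fixing n) => // j; lia. Qed.

End Givens.

(** * Differentiability of one-parameter groups *)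

Section OneParameter.
Variable R : realType.

(** The base point -1 only serves to have 0 inside the interval on which the
    integral is differentiable. *)
Lemma continuous_primitive (f : R -> R) : continuous f ->
  exists F : R -> R, forall x : R, -1 < x -> is_derive x (1 : R) F (f x).
Proof.
move=> cf.
exists (fun x => (\int[lebesgue_measure]_(t in [set` `[-1 : R, x]]) (f t))%R).
move=> x x1.
have xu : x < x + 1 by rewrite ltrDl.
have fint : (lebesgue_measure : measure _ _).-integrable
    `[-1 : R, x + 1] (EFin \o f).
  apply: continuous_compact_integrable; first exact: segment_compact.
  exact: continuous_subspaceT.
have [dF eF] := continuous_FTC1_closed xu fint x1 (cf x).
by split; [exact: dF|rewrite -derive1E eF].
Qed.

Lemma det_cvg (T : Type) (F : set_system T) (FF : Filter F) n
    (f : T -> 'M[R]_n) (A : 'M[R]_n) :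
  (forall i j, f x i j @[x --> F] --> A i j) ->
    \det (f x) @[x --> F] --> \det A.
Proof.
move=> fA; apply: cvg_big; first exact: add_continuous.
move=> s _; apply: cvgM; first exact: cvg_cst.
by apply: cvg_big; first exact: mul_continuous.
Qed.

Variables (n : nat) (h : R -> 'M[R]_n).
Hypothesis hD : forall t u, h (t + u) = h t *m h u.
Hypothesis h0 : h 0 = 1%:M.
Hypothesis hc : forall i j, continuous (fun t => h t i j).

(** Integrating h (t + s) = h t * h s over s in [0, e], with F a primitive of
    h. *)
Lemma oneparam_increment (F : 'I_n -> 'I_n -> R -> R) :
  (forall i j (x : R), -1 < x -> is_derive x (1:R) (F i j) (h x i j)) ->
  forall t e : R, `|t| < 1/2 -> 0 < e < 1/4 ->
  (\matrix_(i, j) (F i j (t + e) - F i j t)) =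
    h t *m \matrix_(i, j) (F i j e - F i j 0).
Proof.
move=> dF t e; rewrite ltr_norml => /andP[t1 t2] /andP[e0 e1].
apply/matrixP => i j; rewrite !mxE.
pose g (s : R) : R := F i j (s + t) - \sum_(l < n) h t i l * F l j s.
have dg (s : R) : -(1/4) < s < 1/4 -> is_derive s (1 : R) g 0.
  move=> /andP[s1 s2].
  have d1 : is_derive s (1 : R) (F i j \o (fun x => x + t)) (h (s + t) i j * 1).
    apply: is_derive1_comp; first by apply: dF; lra.
    exact: is_derive_shift.
  have d2 : is_derive s (1 : R) (\sum_(l < n) (h t i l \*: F l j))
    (\sum_(l < n) (h t i l * h s l j)).
    apply: is_derive_sum => l; apply: is_deriveZ; apply: dF; lra.
  have -> : g = F i j \o (fun x => x + t) - (\sum_(l < n) (h t i l \*: F l j)).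
    by apply/funext => x; rewrite /g /= !fctE fct_sumE.
  apply: (is_derive_eq (is_deriveB d1 d2)).
  by rewrite mulr1 (addrC s) hD mxE subrr.
have [||c _] := @MVT_segment R g (fun=> 0) 0 e (ltW e0).
- by move=> x; rewrite in_itv/= => /andP[x0 xe]; apply: dg; lra.
- apply: derivable_within_continuous => x; rewrite in_itv/= => /andP[x0 xe].
  have xx : -(1/4) < x < 1/4 by lra.
  by have [] := dg _ xx.
rewrite mul0r /g => /eqP; rewrite subr_eq0 add0r (addrC e) => /eqP gg.
have -> : F i j (t + e) - F i j t =
    \sum_l h t i l * F l j e - \sum_l h t i l * F l j 0 by lra.
by rewrite -sumrB; apply: eq_bigr => l _; rewrite mxE mulrBr.
Qed.

(** A continuous homomorphism from the reals to matrices is differentiable.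
    With F a primitive of h, the matrix P e = F e - F 0 satisfies
    F (t + e) - F t = h t * P e and is invertible for small e, since P e / e
    tends to h 0 = 1. So h is a difference of differentiable functions,
    multiplied by the inverse of P e. *)
Lemma oneparam_generator : exists A : 'M[R]_n,
  forall i j, is_derive (0 : R) (1 : R) (fun t => h t i j) (A i j).
Proof.
have /choice[G GP] : forall ij : 'I_n * 'I_n, exists F : R -> R,
    forall x : R, -1 < x -> is_derive x (1 : R) F (h x ij.1 ij.2).
  by move=> ij; apply: continuous_primitive; exact: hc.
pose F i j := G (i, j).
have dF i j (x : R) : -1 < x -> is_derive x (1:R) (F i j) (h x i j) :=
  GP (i, j) x.
pose P e : 'M[R]_n := \matrix_(i, j) (F i j e - F i j 0).
have cP : \det (e^-1 *: P e) @[e --> 0^'] --> (1 : R).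
  rewrite -(det1 R n) -h0; apply: det_cvg => i j.
  have [dFij vF] := dF i j 0 (ltrN10 R).
  have := dFij; rewrite /derivable => /cvg_ex[l hl].
  have -> : h 0 i j = l.
    by rewrite -vF; apply: cvg_lim.
  move: hl; apply: cvg_trans; apply: near_eq_cvg; near=> e.
  by rewrite !mxE /= addr0 [e%:A]mulr1.
have : \forall e \near (0:R)^'+, [/\ 0 < e, e < 1/4 & \det (e^-1 *: P e) != 0].
  near=> e; split; [by []|by near: e; apply: nbhs_right_lt; lra|].
  near: e.
  have : \forall e \near (0:R)^', \det (e^-1 *: P e) != 0.
    apply: (cvgr_neq0 _ cP); exact: oner_neq0.
  rewrite /at_right /dnbhs !near_withinE; apply: filterS => e He e0.
  by apply: He; rewrite gt_eqF.
move=> /filter_ex[e [e0 e1 dPe]].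
have uP : P e \in unitmx.
  rewrite unitmxE unitfE; apply: contraNneq dPe => d0.
  by rewrite detZ d0 mulr0.
exists ((h e - h 0) *m invmx (P e)) => i j.
have hE t : `|t| < 1/2 ->
    h t = (\matrix_(i, j) (F i j (t + e) - F i j t)) *m invmx (P e).
  by move=> t1; rewrite (oneparam_increment dF)// ?e0// mulmxK.
apply: (@near_eq_is_derive _ _ _
   (\sum_(l < n) (invmx (P e) l j \*: (F i l \o (fun x => x + e) - F i l)))).
  near=> t; rewrite fct_sumE [in RHS]hE ?mxE.
    by apply: eq_bigr => l _; rewrite mxE mulrC.
  near: t; apply: (@nbhs0_lt R R); lra.
have d1 l : is_derive (0 : R) (1 : R) (F i l \o (fun x => x + e))
    (h (0 + e) i l * 1).
  apply: is_derive1_comp; first by apply: dF; lra.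
  exact: is_derive_shift.
have d2 l : is_derive (0 : R) (1 : R) (F i l) (h 0 i l) by apply: dF; lra.
rewrite mxE; apply: is_derive_eq.
by apply: eq_bigr => l _; rewrite !mxE add0r mulr1 mulrC.
Unshelve. all: by end_near. Qed.

End OneParameter.

(** * Matrix norm and strict differentiability *)

Section MatrixNorm.
Variable R : realType.

Lemma entry_le_norm m n (A : 'M[R]_(m, n)) i j : `|A i j| <= `|A|.
Proof.
by rewrite [leRHS]/Num.Def.normr/= mx_normrE; apply/bigmax_geP; right;
  exists (i, j).
Qed.

Lemma mx_norm_le m n (A : 'M[R]_(m, n)) c : 0 <= c ->
  (forall i j, `|A i j| <= c) -> `|A| <= c.
Proof.
move=> c0 Ac; rewrite [leLHS]/Num.Def.normr/= mx_normrE; exact: bigmax_le.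
Qed.

Lemma mulmx_norm m n p (A : 'M[R]_(m, n)) (B : 'M[R]_(n, p)) :
  `|A *m B| <= n%:R * `|A| * `|B|.
Proof.
apply: mx_norm_le => [|i j]; first by rewrite !mulr_ge0.
rewrite mxE; apply: (le_trans (ler_norm_sum _ _ _)).
rewrite -mulrA mulr_natl -[X in _ *+ X]card_ord -sumr_const.
by apply: ler_sum => k _; rewrite normrM ler_pM// entry_le_norm.
Qed.

Lemma trmx_norm m n (A : 'M[R]_(m, n)) : `|A^T| = `|A|.
Proof.
apply/eqP; rewrite eq_le; apply/andP; split.
  by apply: mx_norm_le => // i j; rewrite mxE entry_le_norm.
by apply: mx_norm_le => // i j; have := entry_le_norm A^T j i; rewrite mxE.
Qed.

End MatrixNorm.

Section StrictDifferential.
Variables (R : realType) (n : nat).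

(** Strict differentiability at the origin: the remainder is o(x - y) as x and
    y both tend to 0. It replaces continuous differentiability, and it is what
    makes a map a contraction after subtraction of its differential [T]. *)
Definition strict_diff (V : normedModType R) (f T : V -> 'M[R]_n) :=
  forall e, 0 < e -> exists2 d, 0 < d & forall x y, `|x| <= d -> `|y| <= d ->
    `|f x - f y - T (x - y)| <= e * `|x - y|.

Definition bounded_op (V : normedModType R) (T : V -> 'M[R]_n) :=
  exists2 C, 0 < C & forall x, `|T x| <= C * `|x|.

Variable V : normedModType R.
Implicit Types f g T S : V -> 'M[R]_n.

Lemma strict_diff_ext f g T S : f =1 g -> T =1 S -> strict_diff f T ->
  strict_diff g S.
Proof. by move=> /funext -> /funext ->. Qed.

Lemma strict_diff_cst A : strict_diff (fun _ : V => A) (fun=> 0).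
Proof.
by move=> e e0; exists 1 => // x y _ _; rewrite !subrr normr0 mulr_ge0// ltW.
Qed.

Lemma bounded_cst0 : bounded_op (fun _ : V => 0).
Proof. by exists 1 => // x; rewrite normr0 mul1r. Qed.

Lemma strict_diff_add f g T S : strict_diff f T -> strict_diff g S ->
  strict_diff (fun x => f x + g x) (fun x => T x + S x).
Proof.
move=> fT gS e e0; have e2 : 0 < e / 2 by lra.
have [d1 d10 H1] := fT _ e2; have [d2 d20 H2] := gS _ e2.
exists (Num.min d1 d2) => [|x y]; first by rewrite lt_min d10.
rewrite !le_min => /andP[x1 x2] /andP[y1 y2].
have -> : f x + g x - (f y + g y) - (T (x - y) + S (x - y)) =
  (f x - f y - T (x - y)) + (g x - g y - S (x - y)).
  by rewrite !opprD !addrA; apply/matrixP => i j; rewrite !mxE; ring.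
apply: (le_trans (ler_normD _ _)).
have := H1 _ _ x1 y1; have := H2 _ _ x2 y2; lra.
Qed.

Lemma strict_diff_tr f T : strict_diff f T ->
  strict_diff (fun x => (f x)^T) (fun x => (T x)^T).
Proof.
move=> fT e /fT[d d0 Hd]; exists d => // x y xd yd.
have -> : (f x)^T - (f y)^T - (T (x - y))^T = (f x - f y - T (x - y))^T.
  by apply/matrixP => i j; rewrite !mxE.
by rewrite trmx_norm Hd.
Qed.

Lemma strict_diff_linear T : {morph T : x y / x - y} -> strict_diff T T.
Proof.
move=> TB e e0; exists 1 => // x y _ _.
by rewrite TB subrr normr0 mulr_ge0// ltW.
Qed.

Lemma bounded_op_add T S : bounded_op T -> bounded_op S ->
  bounded_op (fun x => T x + S x).
Proof.
move=> [C C0 TC] [D D0 SD]; exists (C + D) => [|x]; first lra.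
by apply: (le_trans (ler_normD _ _)); rewrite mulrDl lerD.
Qed.

Lemma bounded_op_tr T : bounded_op T -> bounded_op (fun x => (T x)^T).
Proof. by move=> [C C0 TC]; exists C => // x; rewrite trmx_norm. Qed.

Lemma bounded_op_mull T A : bounded_op T -> bounded_op (fun x => A *m T x).
Proof.
move=> [C C0 TC]; exists (n%:R * `|A| * C + 1) => [|x].
  by rewrite ltr_pwDr// !mulr_ge0// ltW.
apply: (le_trans (mulmx_norm _ _)); rewrite mulrDl mul1r ler_wpDr//.
by rewrite -[leRHS]mulrA ler_wpM2l// mulr_ge0.
Qed.

Lemma strict_diff_lipschitz f T : strict_diff f T -> bounded_op T ->
  exists C d, [/\ 0 < C, 0 < d & forall x, `|x| <= d ->
    `|f x - f 0| <= C * `|x|].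
Proof.
move=> fT [C C0 TC]; have [d d0 Hd] := fT 1 ltr01.
exists (1 + C), d; split=> // [|x xd]; first lra.
have := Hd x 0 xd; rewrite normr0 => /(_ (ltW d0)); rewrite subr0 => H.
have -> : f x - f 0 = (f x - f 0 - T x) + T x by rewrite subrK.
by apply: (le_trans (ler_normD _ _)); rewrite mulrDl lerD.
Qed.

(** Leibniz rule. With z = x - y, the remainder splits into four products with
    one small factor each: the remainders of f and g, and the increments
    g x - g 0 and f y - f 0. *)
Lemma strict_diff_mul f g T S : strict_diff f T -> bounded_op T ->
  strict_diff g S -> bounded_op S ->
  strict_diff (fun x => f x *m g x) (fun x => T x *m g 0 + f 0 *m S x).
Proof.
move=> fT bT gS bS e e0.
have [C1 [d1 [C10 d10 H1]]] := strict_diff_lipschitz fT bT.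
have [C2 [d2 [C20 d20 H2]]] := strict_diff_lipschitz gS bS.
have [B1 B10 TB] := bT; have [B2 B20 SB] := bS.
(* K bounds the other factor of each product, including the factor n of
   submultiplicativity; so a smallness e' = e / 4K suffices for all four. *)
pose K := n%:R * (`|f 0| + C1 + `|g 0| + C2 + B1 + B2) + 1.
have n0 : 0 <= n%:R :> R by [].
have f0 := normr_ge0 (f 0); have g0 := normr_ge0 (g 0).
have K0 : 0 < K by rewrite /K ltr_wpDl// mulr_ge0//; lra.
pose e' := e / (4 * K).
have e'0 : 0 < e' by rewrite divr_gt0// mulr_gt0.
have [d3 d30 H3] := fT _ e'0; have [d4 d40 H4] := gS _ e'0.
pose d5 := e' / (C1 + C2).
have d50 : 0 < d5 by rewrite divr_gt0//; lra.
exists (Num.min 1 (Num.min d5 (Num.min (Num.min d1 d2) (Num.min d3 d4)))).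
  by rewrite !lt_min ltr01 d50 d10 d20 d30 d40.
move=> x y; rewrite !le_min => /and3P[x01 x5 /andP[/andP[x1 x2] /andP[x3 x4]]].
move=> /and3P[y01 y5 /andP[/andP[y1 y2] /andP[y3 y4]]].
set z := x - y.
have -> : f x *m g x - f y *m g y - (T z *m g 0 + f 0 *m S z) =
  ((f x - f y - T z) *m g x + T z *m (g x - g 0)) +
  (f y *m (g x - g y - S z) + (f y - f 0) *m S z).
  rewrite !(mulmxBl, mulmxBr).
  by apply/matrixP => i j; rewrite !mxE; ring.
have gx : n%:R * `|g x| <= K.
  have : `|g x| <= `|g 0| + C2.
    rewrite -[g x](subrK (g 0)) addrC; apply: (le_trans (ler_normD _ _)).
    by rewrite lerD2l (le_trans (H2 _ x2))// ler_piMr// ltW.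
  move=> gb; rewrite /K ler_wpDr// ler_wpM2l//; lra.
have fy : n%:R * `|f y| <= K.
  have : `|f y| <= `|f 0| + C1.
    rewrite -[f y](subrK (f 0)) addrC; apply: (le_trans (ler_normD _ _)).
    by rewrite lerD2l (le_trans (H1 _ y1))// ler_piMr// ltW.
  move=> gb; rewrite /K ler_wpDr// ler_wpM2l//; lra.
have B1K : n%:R * B1 <= K by rewrite /K ler_wpDr// ler_wpM2l//; lra.
have B2K : n%:R * B2 <= K by rewrite /K ler_wpDr// ler_wpM2l//; lra.
have small C w : 0 < C -> C <= C1 + C2 -> `|w : V| <= d5 -> C * `|w| <= e'.
  move=> C0 CC wd; apply: (@le_trans _ _ ((C1 + C2) * d5)).
    by rewrite ler_pM// ltW.
  by rewrite /d5 mulrC divfK// gt_eqF//; lra.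
have gx0 : `|g x - g 0| <= e'.
  by apply: (le_trans (H2 _ x2)); apply: small => //; lra.
have fy0 : `|f y - f 0| <= e'.
  by apply: (le_trans (H1 _ y1)); apply: small => //; lra.
have z0 := normr_ge0 z.
have e'K : e' * K = e / 4.
  by rewrite /e'; field; rewrite gt_eqF.
have bound (A B : 'M[R]_n) a b : 0 <= a -> `|A| <= a * `|z| ->
  n%:R * `|B| <= b -> a * b <= e / 4 ->
    `|A *m B| <= e / 4 * `|z|.
  move=> a0 Aa Bb ab; apply: (le_trans (mulmx_norm _ _)).
  rewrite mulrAC mulrC; apply: (@le_trans _ _ (a * `|z| * b)).
    by rewrite ler_pM// mulr_ge0.
  by rewrite mulrAC ler_wpM2r.
have p1 : `|(f x - f y - T z) *m g x| <= e / 4 * `|z|.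
  by apply: (bound _ _ e' K) => //; [exact: ltW|exact: H3|rewrite e'K].
have p2 : `|T z *m (g x - g 0)| <= e / 4 * `|z|.
  apply: (bound _ _ B1 (n%:R * e')) => //; [exact: ltW|exact: ler_wpM2l|].
  by rewrite mulrCA mulrA mulrC -e'K ler_wpM2l// ltW.
have bound' (A B : 'M[R]_n) a b : 0 <= b -> `|B| <= b * `|z| ->
  n%:R * `|A| <= a -> a * b <= e / 4 ->
    `|A *m B| <= e / 4 * `|z|.
  move=> b0 Bb Aa ab; apply: (le_trans (mulmx_norm _ _)).
  apply: (@le_trans _ _ (a * (b * `|z|))).
    by rewrite ler_pM// mulr_ge0.
  by rewrite mulrA ler_wpM2r.
have p3 : `|f y *m (g x - g y - S z)| <= e / 4 * `|z|.
  apply: (bound' _ _ K e') => //; [exact: ltW|exact: H4|by rewrite mulrC e'K].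
have p4 : `|(f y - f 0) *m S z| <= e / 4 * `|z|.
  apply: (bound' _ _ (n%:R * e') B2) => //; [exact: ltW|exact: ler_wpM2l|].
  by rewrite mulrAC mulrC -e'K ler_wpM2l// ltW.
apply: (le_trans (ler_normD _ _)).
have q1 := ler_normD ((f x - f y - T z) *m g x) (T z *m (g x - g 0)).
have q2 := ler_normD (f y *m (g x - g y - S z)) ((f y - f 0) *m S z).
lra.
Qed.

Lemma strict_diff_mull f T B :
  strict_diff f T -> bounded_op T ->
    strict_diff (fun x => B *m f x) (fun x => B *m T x).
Proof.
move=> fT bT; apply: strict_diff_ext (strict_diff_mul
  (strict_diff_cst B) _ fT bT) => //.
  by move=> z; rewrite mul0mx add0r.
exact: bounded_cst0.
Qed.

Lemma strict_diff_mulr f T B :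
  strict_diff f T -> bounded_op T ->
    strict_diff (fun x => f x *m B) (fun x => T x *m B).
Proof.
move=> fT bT; apply: strict_diff_ext (strict_diff_mul fT bT
  (strict_diff_cst B) _) => //.
  by move=> z; rewrite mulmx0 addr0.
exact: bounded_cst0.
Qed.

End StrictDifferential.

(** * Tangent directions of a matrix group *)

Section InverseMapping.
Variables (R : realType) (V : completeNormedModType R).

(** The quantitative part of the inverse mapping theorem: to solve f x = w,
    apply the contraction principle to x - f x + w on the closed ball of
    radius d. *)
Lemma near_identity_surjective (f : V -> V) (d : R) : 0 < d ->
  (forall x y, `|x| <= d -> `|y| <= d ->
     `|f x - f y - (x - y)| <= 1 / 2 * `|x - y|) ->
  forall w, `|w - f 0| <= d / 2 -> exists2 x, `|x| <= d & f x = w.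
Proof.
move=> d0 Hf w wd; pose U : set V := [set x | `|x| <= d].
pose g x := x - f x + w.
have gB x y : U x -> U y -> `|g x - g y| <= 1 / 2 * `|x - y|.
  move=> Ux Uy; rewrite /g -normrN.
  have -> : - (x - f x + w - (y - f y + w)) = f x - f y - (x - y).
    rewrite [X in - (_ + X)]opprD (addrACA (x - f x)) subrr addr0 !opprB.
    by rewrite addrACA (addrC y) [RHS]addrACA.
  exact: Hf.
have U0 : U 0 by rewrite /U/= normr0 ltW.
have gU : set_fun U U g.
  move=> x Ux; rewrite /U/= -[g x](subrK (g 0)).
  apply: (le_trans (ler_normD _ _)).
  have h1 := gB x 0 Ux U0; rewrite subr0 in h1.
  have h2 : `|g 0| <= d / 2 by rewrite /g sub0r addrC.
  have Ux' : `|x| <= d := Ux.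
  lra.
have [phi phiE] : exists phi : {fun U >-> U}, phi =1 g.
  have mg : isFun V V U U g by split.
  by exists (HB.pack_for {fun U >-> U} g mg).
have cphi : is_contraction phi.
  exists (1 / 2)%:nng; split => /=; first lra.
  by move=> [x y] /= [Ux Uy]; rewrite !phiE; exact: gB.
have clU : closed U.
  have -> : U = (fun x : V => `|x|) @^-1` [set x : R | x <= d] by [].
  by apply: closed_comp => [x _|]; [exact: norm_continuous|exact: closed_le].
have [|x Ux xE] := banach_fixed_point cphi clU; first by exists 0.
exists x => //; move: xE; rewrite phiE /g => /(congr1 (+%R^~ (f x))) /=.
by rewrite addrAC subrK => /addrI.
Qed.

End InverseMapping.

Section Tangent.
Variables (R : realType) (n : nat) (H : set 'M[R]_n).

(** For the abstract group [H], this plays the role of membership in the Lie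
    algebra. Strict differentiability at 0 is inherited by products of curves
    in [H], and it makes a product of several curves, as a function of all its
    arguments, close to its linear part. *)
Definition tangent (A : 'M[R]_n) := exists g : R -> 'M[R]_n,
  [/\ forall t, H (g t), g 0 = 1%:M
    & strict_diff (V := R^o) g (fun z => z *: A)].

Lemma bounded_op_scale (A : 'M[R]_n) : bounded_op (V := R^o) (fun z => z *: A).
Proof.
exists (`|A| + 1) => [|x]; first by rewrite ltr_wpDl.
by rewrite normrZ mulrC mulrDl ler_wpDr// mul1r.
Qed.

Hypothesis HG : matrix_subgroup H.

Let H1 : H 1%:M. Proof. by case: HG. Qed.
Let HM A B : H A -> H B -> H (A *m B).
Proof. by case: HG => _ _ + _; apply. Qed.
Let HV A : H A -> H (invmx A). Proof. by case: HG => _ _ _; apply. Qed.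
Let HU A : H A -> A \in unitmx. Proof. by case: HG => + _ _ _; apply. Qed.

Lemma tangent0 : tangent 0.
Proof.
exists (fun=> 1%:M); split=> //;
  apply: strict_diff_ext (@strict_diff_cst _ _ _ _) => // z.
by rewrite scaler0.
Qed.

Lemma tangent_scale c A : tangent A -> tangent (c *: A).
Proof.
move=> [g [gH g0 gd]]; exists (fun t => g (c * t)); split => //.
  by rewrite mulr0.
move=> e e0; pose C := `|c| + 1; have C0 : 0 < C by rewrite ltr_wpDl.
have eC : 0 < e / C by rewrite divr_gt0.
have [d d0 Hd] := gd _ eC; exists (d / C); first by rewrite divr_gt0.
have le x : `|x| <= d / C -> `|c * x| <= d.
  move=> xd; rewrite normrM; apply: (@le_trans _ _ (C * (d / C))).
    by rewrite ler_pM// lerDl.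
  by rewrite mulrC divfK// gt_eqF.
move=> x y /le xd /le yd; have := Hd _ _ xd yd.
rewrite scalerA -mulrBr (mulrC (x - y)) => /le_trans; apply.
have cC : e / C * `|c| <= e.
  rewrite -[leRHS](divfK (lt0r_neq0 C0)) ler_wpM2l ?ltW// /C.
  by rewrite ltrDl.
by rewrite normrM mulrA ler_wpM2r.
Qed.

Lemma tangent_add A B : tangent A -> tangent B -> tangent (A + B).
Proof.
move=> [g [gH g0 gd]] [k [kH k0 kd]].
exists (fun t => g t *m k t); split => [t||].
- exact: HM.
- by rewrite g0 k0 mulmx1.
apply: strict_diff_ext (strict_diff_mul gd _ kd _) => //;
  try exact: bounded_op_scale.
by move=> z; rewrite g0 k0 mulmx1 mul1mx scalerDr.
Qed.

Lemma tangent_sum (I : Type) (r : seq I) (P : pred I) (F : I -> 'M[R]_n) :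
  (forall i, P i -> tangent (F i)) -> tangent (\sum_(i <- r | P i) F i).
Proof. by move=> TF; apply: big_ind => //;
  [exact: tangent0|exact: tangent_add]. Qed.

Lemma tangent_conj A B : H B -> tangent A -> tangent (B *m A *m invmx B).
Proof.
move=> HB [g [gH g0 gd]]; exists (fun t => B *m g t *m invmx B); split => [t||].
- exact/HM/HV/HB/HM.
- by rewrite g0 mulmx1 mulmxV// HU.
apply: strict_diff_ext (strict_diff_mulr _ (strict_diff_mull B gd _) _) => //.
- by move=> z; rewrite -scalemxAr -scalemxAl.
- exact: bounded_op_scale.
- exact/bounded_op_mull/bounded_op_scale.
Qed.

Hypothesis HO : H `<=` orthogonal_group R n.

(** The bracket [A, B] is the derivative at t = 0 of g t B (g t)^-1, where g
    is a curve in [H] with velocity A. The difference quotients are tangent,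
    and this avoids showing that the tangent directions form a closed set. *)
Lemma tangent_bracket A B e : 0 < e -> A^T = - A -> tangent A -> tangent B ->
  exists2 Z, tangent Z & `|Z - (A *m B - B *m A)| <= e.
Proof.
move=> e0 sA [g [gH g0 gd]] TB.
have dA := bounded_op_scale A.
have gtd := strict_diff_tr gd; have bt := bounded_op_tr dA.
(* The inverse of g t is its transpose, whose velocity is A^T = - A. *)
have [d d0 Hd] := strict_diff_mul gd dA (strict_diff_mull B gtd bt)
  (bounded_op_mull B bt) e0.
have := Hd d 0; rewrite normr0 (gtr0_norm d0) lexx => /(_ isT (ltW d0)).
rewrite subr0 (gtr0_norm d0) g0 trmx1 !mul1mx !mulmx1 => h.
exists (d^-1 *: (g d *m B *m invmx (g d) - B)).
  apply: tangent_scale; rewrite -scaleN1r.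
  by apply: tangent_add; [exact: tangent_conj|exact: tangent_scale].
have -> : d^-1 *: (g d *m B *m invmx (g d) - B) - (A *m B - B *m A) =
   d^-1 *: (g d *m (B *m (g d)^T) - B - (d *: A *m B + B *m (d *: A)^T)).
  rewrite orthogonal_invmx ?mulmxA; last exact: HO.
  rewrite [in RHS]scalerBr; congr (_ - _).
  rewrite linearZ/= sA -scalemxAl -scalemxAr -scalerDr scalerA mulVf ?gt_eqF//.
  by rewrite scale1r mulmxN.
by rewrite normrZ gtr0_norm ?invr_gt0// ler_pdivrMl// mulrC.
Qed.

End Tangent.

(** * From tangent directions to SO(n) *)

(** The norm and the completeness of matrices have to be joined for the
    contraction principle to apply to them. *)
HB.instance Definition _ (R : realType) (m n : nat) := Complete.on 'M[R]_(m, n).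

Section Neighbourhood.
Variables (R : realType) (n : nat) (H : set 'M[R]_n).
Hypothesis HG : matrix_subgroup H.
Hypothesis HO : H `<=` orthogonal_group R n.

Let H1 : H 1%:M. Proof. by case: HG. Qed.
Let HM A B : H A -> H B -> H (A *m B).
Proof. by case: HG => _ _ + _; apply. Qed.

Lemma strict_diff_entry (g : R -> 'M[R]_n) (A : 'M[R]_n) (i j : 'I_n) :
  strict_diff (V := R^o) g (fun z => z *: A) ->
  strict_diff (fun X : 'M[R]_n => g (X i j)) (fun X => X i j *: A).
Proof.
move=> gA e e0; have [d d0 Hd] := gA _ e0; exists d => // X Y Xd Yd.
have := Hd _ _ (le_trans (entry_le_norm X i j) Xd) (le_trans
  (entry_le_norm Y i j) Yd).
have XY : (X - Y) i j = X i j - Y i j by rewrite !mxE.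
rewrite -XY => /le_trans; apply.
by rewrite ler_wpM2l ?entry_le_norm// ltW.
Qed.

Lemma product_chart (Z : 'I_n * 'I_n -> 'M[R]_n) (s : seq ('I_n * 'I_n)) :
  (forall p, tangent H (Z p)) ->
  exists F : 'M[R]_n -> 'M[R]_n, [/\ forall X, H (F X), F 0 = 1%:M,
    strict_diff F (fun X => \sum_(p <- s) X p.1 p.2 *: Z p) &
    bounded_op (fun X : 'M[R]_n => \sum_(p <- s) X p.1 p.2 *: Z p)].
Proof.
move=> TZ; elim: s => [|p s [F [FH F0 Fd Fb]]].
  exists (fun=> 1%:M); split => //.
    by apply: strict_diff_ext (strict_diff_cst _ _) => // X; rewrite big_nil.
  by under eq_fun do rewrite big_nil; exact: bounded_cst0.
have [g [gH g0 gd]] := TZ p.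
have bp : bounded_op (fun X : 'M[R]_n => X p.1 p.2 *: Z p).
  exists (`|Z p| + 1) => [|X]; first by rewrite ltr_wpDl.
  by rewrite normrZ mulrC ler_pM// ?entry_le_norm// lerDl.
exists (fun X : 'M[R]_n => g (X p.1 p.2) *m F X); split.
- by move=> X; exact: HM.
- by rewrite mxE g0 F0 mulmx1.
- apply: strict_diff_ext (strict_diff_mul
    (strict_diff_entry _ _ gd) bp Fd Fb) => // X.
  by rewrite big_cons mxE g0 F0 mulmx1 mul1mx.
- by under eq_fun do rewrite big_cons; exact: bounded_op_add.
Qed.

Lemma skew_part_sum (X : 'M[R]_n) :
  \sum_(p : 'I_n * 'I_n) X p.1 p.2 *: ((1 / 2) *: wedge R p.1 p.2) =
  (1 / 2) *: (X - X^T).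
Proof.
under eq_bigr do rewrite scalerA mulrC -scalerA scalerBr.
rewrite -scaler_sumr sumrB; congr (_ *: (_ - _)).
  by rewrite [RHS]matrix_sum_delta pair_bigA.
rewrite [RHS]matrix_sum_delta exchange_big/= pair_bigA/=.
by apply: eq_bigr => p _; rewrite mxE.
Qed.

Hypothesis approx : forall i j e, 0 < e ->
  exists2 Z, tangent H Z & `|Z - wedge R i j| <= e.

(** The velocity of the product of all curves in direction X is a sum over all
    ordered pairs (i, j), each of which contributes X i j / 2 times an
    approximation of [wedge i j]. Exact wedges would give the skew part of X;
    the error is kept below a quarter of the norm of X. *)
Lemma nearby_chart : exists F T, [/\ forall X, H (F X), F 0 = 1%:M,
  @strict_diff R n 'M[R]_n F T, bounded_op T &
  forall X : 'M[R]_n, `|T X - (1 / 2) *: (X - X^T)| <= 1 / 4 * `|X|].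
Proof.
pose c : R := #|{: 'I_n * 'I_n}|%:R; have c0 : 0 <= c by rewrite ler0n.
pose e := (4 * (c + 1))^-1.
have e0 : 0 < e by rewrite invr_gt0 mulr_gt0// ltr_wpDl.
have /choice[Z ZP] : forall p : 'I_n * 'I_n,
    exists Z, tangent H Z /\ `|Z - (1 / 2) *: wedge R p.1 p.2| <= e.
  move=> p; have [Z TZ Ze] := approx p.1 p.2 e0.
  exists ((1 / 2) *: Z); split; first exact: tangent_scale.
  rewrite -scalerBr normrZ ger0_norm; last lra.
  have := normr_ge0 (Z - wedge R p.1 p.2); lra.
have [F [FH F0 Fd Fb]] := product_chart (index_enum _) (fun p => (ZP p).1).
exists F, (fun X : 'M[R]_n => \sum_p X p.1 p.2 *: Z p); split => // X.
rewrite -skew_part_sum -sumrB; apply: (le_trans (ler_norm_sum _ _ _)).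
apply: (@le_trans _ _ (\sum_(p : 'I_n * 'I_n) `|X| * e)).
  apply: ler_sum => p _; rewrite -scalerBr normrZ.
  by rewrite ler_pM// ?entry_le_norm// (ZP p).2.
have -> : \sum_(p : 'I_n * 'I_n) `|X| * e = c * e * `|X|.
  by rewrite sumr_const -[LHS]mulr_natl mulrA mulrAC.
apply: ler_wpM2r => //.
rewrite /e ler_pdivrMr ?mulr_gt0 ?ltr_wpDl//; lra.
Qed.

(** An orthogonal symmetric matrix 1 + S squares to 1, that is 2 S = - S^2,
    which is impossible for small nonzero S. *)
Lemma symmetric_part_trivial (S : 'M[R]_n) : S^T = S ->
  n%:R * `|S| < 2 -> orthogonal_group R n (1%:M + S) -> S = 0.
Proof.
rewrite /orthogonal_group/= => sS S2.
have -> : (1%:M + S)^T = 1%:M + S.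
  by rewrite -[in RHS]sS; apply/matrixP => i j; rewrite !mxE eq_sym.
rewrite mulmxDl mul1mx mulmxDr mulmx1 => E.
have E2 : 2 *: S = - (S *m S).
  apply/eqP; rewrite -addr_eq0; apply/eqP.
  move: E; rewrite -addrA => /(canRL (addKr _)); rewrite addNr => <-.
  by rewrite scaler_nat mulr2n addrA.
have : 2 * `|S| <= n%:R * `|S| * `|S|.
  have := mulmx_norm S S; rewrite -normrN -E2 normrZ ger0_norm//.
have [->//|Sn0] := eqVneq S 0.
by rewrite ler_pM2r ?normr_gt0// leNgt S2.
Qed.

(** The map Phi X = F X (1 + sym X), with F from [nearby_chart] and sym X the
    symmetric part of X, has differential close to X = skew X + sym X at 0; so
    it reaches every matrix near 1. When the value Phi X and F X are both
    orthogonal, so is 1 + sym X, which is then 1. *)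
Lemma subgroup_contains_neighbourhood : exists2 r : R, 0 < r &
  forall M, orthogonal_group R n M -> `|M - 1%:M| <= r -> H M.
Proof.
have [F [T [FH F0 FT bT TX]]] := nearby_chart.
pose sy (X : 'M[R]_n) : 'M[R]_n := (1 / 2) *: (X + X^T).
have syB : {morph sy : X Y / X - Y}.
  by move=> X Y; apply/matrixP => i j; rewrite !mxE; ring.
have sy_le X : `|sy X| <= `|X|.
  rewrite normrZ ger0_norm; last lra.
  have := ler_normD X X^T; rewrite trmx_norm; lra.
have bsy : bounded_op sy by exists 1 => // X; rewrite mul1r.
have b1 : bounded_op (fun X => 0 + sy X).
  by apply: bounded_op_add bsy; exact: bounded_cst0.
pose Phi (X : 'M[R]_n) := F X *m (1%:M + sy X).
have sy0 : sy 0 = 0 by rewrite /sy trmx0 addr0 scaler0.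
have dPhi : strict_diff Phi (fun X => T X + sy X).
  apply: strict_diff_ext (strict_diff_mul FT bT (strict_diff_add
    (strict_diff_cst _ 1%:M) (strict_diff_linear syB)) b1).
    by [].
  by move=> X; rewrite F0 sy0 addr0 mulmx1 mul1mx add0r.
have e4 : (0 : R) < 1 / 4 by lra.
have [d d0 Hd] := dPhi _ e4.
pose r := Num.min d (n.+1%:R)^-1.
have r0 : 0 < r by rewrite lt_min d0 invr_gt0 ltr0n.
have contr (X Y : 'M[R]_n) : `|X| <= r -> `|Y| <= r ->
    `|Phi X - Phi Y - (X - Y)| <= 1 / 2 * `|X - Y|.
  rewrite !le_min => /andP[Xd _] /andP[Yd _].
  set Z := X - Y.
  have -> : Phi X - Phi Y - Z = (Phi X - Phi Y - (T Z + sy Z)) +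
      (T Z - (1 / 2) *: (Z - Z^T)).
    by apply/matrixP => i j; rewrite /sy; move: (T Z) => TZ;
      rewrite ![in LHS]mxE ![in RHS]mxE; field.
  apply: (le_trans (ler_normD _ _)).
  have := Hd _ _ Xd Yd; have := TX Z; rewrite -/Z; lra.
exists (r / 2) => [|M oM Mr]; first lra.
have Phi0 : Phi 0 = 1%:M by rewrite /Phi F0 sy0 addr0 mulmx1.
have [|X Xr XM] := near_identity_surjective r0 contr (w := M);
  first by rewrite Phi0.
have oF : orthogonal_group R n (F X) by apply: HO.
have symE : 1%:M + sy X = (F X)^T *m M.
  by rewrite -XM /Phi mulmxA oF mul1mx.
suff S0 : sy X = 0 by rewrite -XM /Phi S0 addr0 mulmx1.
apply: symmetric_part_trivial.
- by apply/matrixP => i j; rewrite !mxE; ring.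
- have Xn : `|X| <= n.+1%:R^-1 by move: Xr; rewrite le_min => /andP[].
  apply: (@le_lt_trans _ _ 1); last lra.
  apply: (@le_trans _ _ (n.+1%:R * n.+1%:R^-1)); last by rewrite divff.
  by rewrite ler_pM// ?ler_nat//; exact: le_trans Xn.
- rewrite symE /orthogonal_group/= trmx_mul trmxK mulmxA -(mulmxA _ (F X)).
  by rewrite (mulmx1C oF) mulmx1 oM.
Qed.

(** SO(n) is connected, in the concrete form that a rotation is a power of a
    small rotation. *)
Lemma subgroup_contains_SO : special_orthogonal_group R n `<=` H.
Proof.
have [r r0 Hr] := subgroup_contains_neighbourhood.
apply: SO_sub_of_plane_rot => //.
move=> i j t ij.
have small : \forall u \near (0 : R), `|plane_rot i j u - 1%:M| <= r.
  pose C := `|plane_proj R i j| + `|wedge R j i| + 1.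
  have C0 : 0 < C by rewrite ltr_wpDl// addr_ge0.
  have rC : 0 < r / C by rewrite divr_gt0.
  have cc : \forall u \near (0 : R), `|cos u - 1| <= r / C.
    have := @continuous_cos R 0; rewrite /continuous_at cos0.
    by move=> /cvgrPdist_le/(_ _ rC); apply: filterS => u; rewrite distrC.
  have ss : \forall u \near (0 : R), `|sin u| <= r / C.
    have := @continuous_sin R 0; rewrite /continuous_at sin0.
    by move=> /cvgrPdist_le/(_ _ rC); apply: filterS => u; rewrite distrC subr0.
  near=> u.
  have cu : `|cos u - 1| <= r / C by near: u.
  have su : `|sin u| <= r / C by near: u.
  rewrite /plane_rot addrC !addrA addNr add0r;
    apply: (le_trans (ler_normD _ _)).
  rewrite !normrZ; apply: (@le_trans _ _ (r / C * C));
    last by rewrite divfK ?gt_eqF.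
  have -> : r / C * C = r / C * `|plane_proj R i j| +
      (r / C * `|wedge R j i| + r / C) by rewrite {2}/C; ring.
  by rewrite lerD ?ler_wpDr ?ler_wpM2r ?(ltW rC).
have [m Hm] : exists m : nat, `|plane_rot i j (t / m.+1%:R) - 1%:M| <= r.
  have ct : t / m.+1%:R @[m --> \oo] --> (0 : R).
    rewrite -(mulr0 t); apply: cvgM; first exact: cvg_cst.
    exact: cvg_harmonic.
  have [m _ Hm] := ct _ small.
  by exists m; exact: (Hm m (leqnn m)).
have Hu : H (plane_rot i j (t / m.+1%:R)) by apply: Hr => //;
  exact: plane_rot_orthogonal.
have -> : t = t / m.+1%:R *+ m.+1 by rewrite -[RHS]mulr_natr divfK ?pnatr_eq0.
move: (t / m.+1%:R) Hu => u Hu; elim: (m.+1) => [|k IH].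
  by rewrite mulr0n plane_rot0.
by rewrite mulrS plane_rotD//; exact: HM.
Unshelve. all: by end_near. Qed.

End Neighbourhood.

(** * Averaging over permutations *)

Section Averaging.
Variables (R : realType) (n : nat).

(** The matrix e_i 1^T - 1 e_i^T, where 1 is the all-ones column. *)
Definition wedge_ones (i : 'I_n) : 'M[R]_n :=
  \matrix_(a, b) ((a == i)%:R - (b == i)%:R).

(** Conjugation of A by the permutation matrix of s, see [perm_conjugate]. *)
Definition permuted (A : 'M[R]_n) (s : 'S_n) : 'M[R]_n :=
  \matrix_(a, b) A (s a) (s b).

(** The sum is skew-symmetric and invariant under the transpositions (a b)
    with a, b different from i. So its entries outside row and column i
    vanish, the off-diagonal entries of row i coincide, and their sum is the
    sum of row m of A times the number of permutations that send i to m. *)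
Lemma average_stabilizer (A : 'M[R]_n) (i m : 'I_n) : (2 <= n)%N -> A^T = - A ->
  \sum_j A m j != 0 ->
  exists2 c, c != 0 & \sum_(s : 'S_n | s i == m) permuted A s =
    c *: wedge_ones i.
Proof.
move=> n2 sA r0; set S := \sum_(s | _) _.
have SE a b : S a b = \sum_(s : 'S_n | s i == m) A (s a) (s b).
  by rewrite summxE; apply: eq_bigr => s _; rewrite mxE.
have AE a b : A a b = - A b a.
  by have := congr1 (fun B : 'M[R]_n => B b a) sA; rewrite !mxE.
have Sskew a b : S a b = - S b a.
  by rewrite !SE -sumrN; apply: eq_bigr => s _; exact: AE.
have inv a b x y : a != i -> b != i -> S x y = S (tperm a b x) (tperm a b y).
  move=> ai bi; rewrite !SE (reindex_inj (mulgI (tperm a b)))/=.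
  apply: eq_big => [s|s _]; last by rewrite !permM.
  by rewrite permM tpermD.
have off a b : a != i -> b != i -> S a b = 0.
  move=> ai bi; have := inv a b a b ai bi; rewrite tpermL tpermR (Sskew b a).
  lra.
have [j ji] : exists j, j != i.
  have [z|z] := eqVneq (Ordinal (ltnW n2)) i.
    by exists (Ordinal n2); rewrite -z.
  by exists (Ordinal (ltnW n2)).
have same b : b != i -> S i b = S i j.
  move=> bi; rewrite (inv b j)//.
  by rewrite tpermL tpermD.
have Sii : S i i = 0 by have := Sskew i i; lra.
have SS : S = S i j *: wedge_ones i.
  apply/matrixP => a b; rewrite [RHS]mxE [wedge_ones i a b]mxE.
  have [->|ai] := eqVneq a i; have [->|bi] := eqVneq b i.
  - by rewrite subrr mulr0 Sii.
  - by rewrite subr0 mulr1 same.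
  - by rewrite sub0r mulrN1 Sskew same.
  - by rewrite subrr mulr0 off.
exists (S i j) => //; apply: contraNneq r0 => c0.
have : \sum_b S i b = \sum_(s : 'S_n | s i == m) \sum_j A m j.
  under eq_bigr do rewrite SE.
  rewrite exchange_big/=; apply: eq_bigr => s /eqP sim.
  rewrite [RHS](reindex_inj (@perm_inj _ s))/=.
  by apply: eq_bigr => b _; rewrite sim.
rewrite SS c0 scale0r big1; last by move=> b _; rewrite mxE.
rewrite sumr_const -mulr_natl => /esym/eqP; rewrite mulf_eq0 pnatr_eq0.
move=> /orP[|//]; rewrite -leqn0 leqNgt => /negP[]; apply/card_gt0P.
by exists (tperm i m); rewrite unfold_in; apply/eqP; rewrite tpermL.
Qed.

Lemma tr_wedge_ones i : (wedge_ones i)^T = - wedge_ones i.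
Proof. by apply/matrixP => a b; rewrite !mxE opprB. Qed.

Lemma wedge_ones_mul i j a b : (wedge_ones i *m wedge_ones j) a b =
  (a == i)%:R - n%:R * ((a == i)%:R * (b == j)%:R) - (i == j)%:R +
    (b == j)%:R :> R.
Proof.
rewrite mxE; under eq_bigr do rewrite !mxE mulrBl !mulrBr.
have s1 (k : 'I_n) : \sum_(l < n) (l == k)%:R = 1 :> R.
  by rewrite (bigD1 k)//= eqxx big1 ?addr0// => l /negbTE ->.
rewrite !sumrB -!mulr_sumr -mulr_suml !s1 sumr_const card_ord.
have -> : \sum_(l < n) (l == i)%:R * (l == j)%:R = (i == j)%:R :> R.
  rewrite (bigD1 i)//= eqxx mul1r big1 ?addr0// => l /negbTE ->.
  by rewrite mul0r.
by rewrite -mulr_natl; ring.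
Qed.

Lemma wedge_ones_bracket i j :
  wedge_ones i *m wedge_ones j - wedge_ones j *m wedge_ones i =
  wedge_ones i - wedge_ones j - n%:R *: wedge R i j.
Proof.
apply/matrixP => a b.
have eB (X Y : 'M[R]_n) : (X - Y) a b = X a b - Y a b by rewrite !mxE.
rewrite !eB !wedge_ones_mul !mxE (eq_sym j i) -!mulnb !natrM.
ring.
Qed.

Variable H : set 'M[R]_n.
Hypothesis HG : matrix_subgroup H.
Hypothesis HO : H `<=` orthogonal_group R n.

(** By [wedge_ones_bracket], [wedge i j] is a combination of tangent
    directions and of the bracket of two of them. *)
Lemma wedge_approx (A : 'M[R]_n) (m : 'I_n) : (2 <= n)%N -> A^T = - A ->
  \sum_j A m j != 0 -> (forall s, tangent H (permuted A s)) ->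
  forall i j e, 0 < e -> exists2 Z, tangent H Z & `|Z - wedge R i j| <= e.
Proof.
move=> n2 sA r0 TA.
have TU i : tangent H (wedge_ones i).
  have [c c0 cE] := average_stabilizer i n2 sA r0.
  rewrite -[wedge_ones i]scale1r -(mulVf c0) -scalerA -cE.
  by apply: tangent_scale; apply: tangent_sum => // s _; exact: TA.
move=> i j e e0.
have n0 : n%:R != 0 :> R by rewrite pnatr_eq0; lia.
have n1 : 1 <= n%:R :> R by rewrite ler1n; lia.
have [Z TZ Ze] := tangent_bracket HG HO e0 (tr_wedge_ones i) (TU i) (TU j).
exists (n%:R^-1 *: (wedge_ones i - wedge_ones j - Z)).
  apply: tangent_scale.
  have TN B : tangent H B -> tangent H (- B).
    by rewrite -scaleN1r; exact: tangent_scale.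
  by apply: (tangent_add HG _ (TN _ TZ)); exact: (tangent_add HG _ (TN _ _)).
have -> : n%:R^-1 *: (wedge_ones i - wedge_ones j - Z) - wedge R i j =
   - (n%:R^-1 *:
      (Z - (wedge_ones i *m wedge_ones j - wedge_ones j *m wedge_ones i))).
  rewrite wedge_ones_bracket -[RHS]scalerN [X in _ = _ *: X]opprB.
  by rewrite [X in _ = _ *: X]addrAC [RHS]scalerBr scalerA mulVf// scale1r.
rewrite normrN normrZ ger0_norm ?invr_ge0//.
rewrite ler_pdivrMl ?(lt_le_trans ltr01)//; apply: (le_trans Ze).
by rewrite ler_peMl// ltW.
Qed.

End Averaging.

(** * The generator of a one-parameter group *)

Section OneParameterGroup.
Variables (R : realType) (n : nat) (h : R -> 'M[R]_n).
Hypothesis hD : forall t u, h (t + u) = h t *m h u.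
Hypothesis h0 : h 0 = 1%:M.
Variable A : 'M[R]_n.
Hypothesis hA : forall i j, is_derive (0 : R) (1 : R) (fun t => h t i j)
  (A i j).

(** For a one-parameter group, differentiability at 0 is automatically strict:
    h x - h y = h y (h (x - y) - 1), and h y is close to 1. *)
Lemma oneparam_strict_diff : strict_diff (V := R^o) h (fun z => z *: A).
Proof.
pose K := n%:R * (2 + `|A|) + 1.
have K0 : 0 < K by rewrite ltr_wpDl// mulr_ge0// addr_ge0.
have near0 e : 0 < e -> exists2 d, 0 < d & forall u : R, `|u| <= d ->
    `|h u - 1%:M - u *: A| <= e * `|u|.
  move=> e0.
  have : \forall u \near (0 : R)^',
      forall i j, `|h u i j - h 0 i j - u * A i j| <= e * `|u|.
    apply: filter_forall => i; apply: filter_forall => j.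
    have [dh vh] := hA i j.
    have : u^-1 *: (h u i j - h 0 i j) @[u --> (0 : R)^'] --> A i j.
      have /cvg_ex[l hl] := dh.
      have -> : A i j = l by rewrite -vh; apply: cvg_lim.
      move: hl; apply: cvg_trans; apply: near_eq_cvg; near=> u.
      by rewrite /= addr0 [u%:A]mulr1.
    move=> /cvgrPdist_le/(_ _ e0); rewrite /dnbhs !near_withinE.
    apply: filterS => u Hu un0; have := Hu un0.
    have -> : h u i j - h 0 i j - u * A i j =
        - (u * (A i j - u^-1 *: (h u i j - h 0 i j))).
      by rewrite [_ *: _]/GRing.scale/=; field.
    by rewrite normrN normrM mulrC => ?; rewrite ler_wpM2r.
  rewrite /dnbhs near_withinE => /nbhs_normP[d /= d0 Hd].
  exists (d / 2) => [|u ud]; first lra.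
  have [->|un0] := eqVneq u 0.
    by rewrite h0 subrr scale0r subrr !normr0 mulr0.
  apply: mx_norm_le => [|i j]; first by rewrite mulr_ge0// ltW.
  have /= := Hd u; rewrite sub0r normrN => Hu.
  have := Hu (le_lt_trans ud _) un0 i j.
  by rewrite h0 !mxE; apply; lra.
move=> e e0; have eK : 0 < e / K by rewrite divr_gt0.
have [d1 d10 H1] := near0 _ eK; have [d2 d20 H2] := near0 _ ltr01.
pose d3 := e / K / (1 + `|A|).
have A1 : 0 < 1 + `|A| by rewrite ltr_wpDr.
have d30 : 0 < d3 by rewrite divr_gt0.
exists (Num.min (Num.min (d1 / 2) d2) (Num.min d3 (1 + `|A|)^-1)) => [|x y].
  by rewrite !lt_min d20 d30 invr_gt0 A1 !andbT; lra.
rewrite !le_min => /andP[/andP[x1 _] _] /andP[/andP[y1 y2] /andP[y3 y4]].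
have z1 : `|x - y| <= d1 by have := ler_normB x y; lra.
have hx : h x = h y *m h (x - y) by rewrite -hD addrC subrK.
have -> : h x - h y - (x - y) *: A = h y *m (h (x - y) - 1%:M - (x - y) *: A)
    + (h y - 1%:M) *m ((x - y) *: A).
  by rewrite hx mulmxBr mulmxBr mulmx1 mulmxBl mul1mx addrA subrK.
have hy1 : `|h y - 1%:M| <= (1 + `|A|) * `|y|.
  rewrite -[h y - _](subrK (y *: A)); apply: (le_trans (ler_normD _ _)).
  by rewrite mulrDl lerD ?H2// normrZ mulrC.
have hye : `|h y - 1%:M| <= e / K.
  apply: (le_trans hy1); apply: (@le_trans _ _ ((1 + `|A|) * d3)).
    by rewrite ler_wpM2l// ltW.
  by rewrite /d3 mulrC divfK// gt_eqF.
have hy2 : n%:R * `|h y| <= n%:R * 2.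
  rewrite ler_wpM2l// -[h y](subrK 1%:M); apply: (le_trans (ler_normD _ _)).
  have : `|h y - 1%:M| <= 1.
    apply: (le_trans hy1); apply: (@le_trans _ _ ((1 + `|A|) * (1 + `|A|)^-1)).
      by rewrite ler_wpM2l// ltW.
    by rewrite divff// gt_eqF.
  have : `|(1%:M : 'M[R]_n)| <= 1.
    by apply: mx_norm_le => // i j; rewrite mxE; case: eqP;
      rewrite ?normr1 ?normr0.
  lra.
have z0 := normr_ge0 (x - y).
apply: (le_trans (ler_normD _ _)).
have p1 : `|h y *m (h (x - y) - 1%:M - (x - y) *: A)| <= n%:R * 2 *
  (e / K * `|x - y|).
  by apply: (le_trans (mulmx_norm _ _)); rewrite ler_pM// ?mulr_ge0// H1.
have p2 : `|(h y - 1%:M) *m ((x - y) *: A)| <= n%:R * (e / K) *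
  (`|x - y| * `|A|).
  by apply: (le_trans (mulmx_norm _ _));
    rewrite ler_pM// ?mulr_ge0// ?normrZ// ler_wpM2l.
have -> : e * `|x - y| = n%:R * 2 * (e / K * `|x - y|) + n%:R * (e / K) *
  (`|x - y| * `|A|)
   + e / K * `|x - y|.
  have eE : e = e / K * K by rewrite divfK// gt_eqF.
  by rewrite {1}eE /K; move: (e / _) => q; ring.
have := mulr_ge0 (ltW eK) z0; lra.
Unshelve. all: by end_near. Qed.

(** The derivative of h t v is h t A v = 0, so h t v is constant. *)
Lemma oneparam_fix (v : 'cV[R]_n) : A *m v = 0 -> forall t, h t *m v = v.
Proof.
move=> Av t; apply/colP => i.
pose k (u : R) : R := \sum_l h u i l * v l 0.
have kE u : k u = (h u *m v) i 0 by rewrite mxE.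
suff kc : forall x : R, is_derive x (1 : R) k 0.
  by rewrite -kE (is_derive_0_is_cst t 0 kc) kE h0 mul1mx.
move=> x.
pose w p (u : R) : R := \sum_l h u p l * v l 0.
have dw p : is_derive (0 : R) (1 : R) (w p) 0.
  have -> : w p = \sum_l (v l 0 \*: (fun u => h u p l)).
    by apply/funext => u; rewrite fct_sumE; apply: eq_bigr => l _;
      rewrite mulrC.
  have d0 l : is_derive (0 : R) (1 : R) (v l 0 \*: (fun u => h u p l))
    (v l 0 *: A p l).
    exact: is_deriveZ.
  apply: (is_derive_eq (is_derive_sum d0)).
  have := congr1 (fun B : 'cV_n => B p 0) Av; rewrite !mxE => Av0.
  by rewrite -[RHS]Av0; apply: eq_bigr => l _; exact: mulrC.
have -> : k = (\sum_p (h x i p \*: w p)) \o (fun u => u + - x).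
  apply/funext => u; rewrite kE -[u in LHS](subrK x) addrC hD -mulmxA mxE.
  by rewrite /= fct_sumE; apply: eq_bigr => p _; rewrite [X in _ * X]mxE addrC.
have d1 : is_derive (x - x) (1 : R) (\sum_p (h x i p \*: w p))
  (\sum_(p < n) h x i p *: 0).
  by rewrite subrr; apply: is_derive_sum => p; apply: is_deriveZ.
have d2 : is_derive x (1 : R) (fun u => u + - x) 1 by exact: is_derive_shift.
apply: (is_derive_eq (@is_derive1_comp _ _ (fun u => u + - x) x _ _ d1 d2)).
by rewrite big1 ?mul0r// => p _; rewrite scaler0.
Qed.

Lemma oneparam_skew : (forall t, orthogonal_group R n (h t)) -> A^T = - A.
Proof.
move=> ho; have hT t : (h t)^T = h (- t).
  rewrite -[LHS]mulmx1 -h0 -(subrr t) hD mulmxA.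
  by have := ho t; rewrite /orthogonal_group/= => ->; rewrite mul1mx.
apply/matrixP => i j; rewrite !mxE.
have d1 : is_derive (0 : R) (1 : R) (fun t : R => - t) (- 1).
  exact: is_deriveN.
have d2 : is_derive (- 0 : R) (1 : R) (fun t => h t i j) (A i j)
  by rewrite oppr0.
have := is_derive1_comp d2 d1; rewrite mulrN1.
have -> : (fun t => h t i j) \o (fun t => - t) = (fun t => h t j i).
  by apply/funext => t /=; rewrite -hT mxE.
by move=> [_ <-]; have [_ <-] := hA j i.
Qed.

End OneParameterGroup.

(** * Generation by permutation conjugates *)

Section Subgroups.
Variables (R : realType) (n : nat).

Lemma invmx_perm_mx (s : 'S_n) : invmx (perm_mx s) = perm_mx s^-1 :> 'M[R]_n.
Proof.
by rewrite -[LHS]mulmx1 -(perm_mx1 _ n) -(mulgV s) perm_mxM mulKmx// unitmx_perm.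
Qed.

Lemma perm_mx_orthogonal (s : 'S_n) : orthogonal_group R n (perm_mx s).
Proof. by rewrite /orthogonal_group/= tr_perm_mx -perm_mxM mulVg perm_mx1. Qed.

Lemma perm_conjugate (s : 'S_n) (A : 'M[R]_n) :
  invmx (perm_mx s^-1) *m A *m perm_mx s^-1 = permuted A s.
Proof.
rewrite invmx_perm_mx invgK -row_permE -col_permE.
by apply/matrixP => i j; rewrite !mxE.
Qed.

End Subgroups.

Section Representation.
Variables (R : realType) (k N : nat) (phi : 'M[R]_k -> 'M[R]_N).
Hypothesis hphi : continuous_SO_hom phi.

Let phiSO g : special_orthogonal_group R k g ->
  special_orthogonal_group R N (phi g).
Proof. by have [h _ _] := hphi; exact: h. Qed.

Let phiM g g' : special_orthogonal_group R k g ->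
  special_orthogonal_group R k g' ->
  phi (g *m g') = phi g *m phi g'.
Proof. by have [_ h _] := hphi; exact: h. Qed.

Lemma hom1 : phi 1%:M = 1%:M.
Proof.
have [_ S1 _ _] := SO_subgroup R k; have [U _ _ _] := SO_subgroup R N.
have := phiM S1 S1; rewrite mulmx1 => /(congr1 (mulmx (invmx (phi 1%:M)))).
by rewrite mulKmx ?mulVmx//; exact/U/phiSO.
Qed.

(** The elements of SO(k) whose image fixes v form a group. *)
Lemma fixed_vector_line (v : 'cV[R]_N) : v != 0 ->
  (forall (i j : 'I_k) (t : R), i != j -> phi (plane_rot i j t) *m v = v) ->
  exists L : {vspace 'cV[R]_N}, \dim L = 1%N /\ SO_invariant phi L.
Proof.
move=> v0 fixv; exists <[v]>%VS; split; first by rewrite dim_vline v0.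
pose K := [set g | special_orthogonal_group R k g /\ phi g *m v = v].
have [_ S1 SM SV] := SO_subgroup R k; have [SU _ _ _] := SO_subgroup R k.
suff SK : special_orthogonal_group R k `<=` K.
  by move=> g /SK[_ gv]; rewrite limg_line lfunE/= gv.
apply: SO_sub_of_plane_rot; first split.
- by move=> g [/SU].
- by split; rewrite ?hom1 ?mul1mx.
- move=> g g' [Sg gv] [Sg' gv']; split; first exact: SM.
  by rewrite phiM// -mulmxA gv' gv.
- move=> g [Sg gv]; split; first exact: SV.
  rewrite -[in LHS]gv mulmxA -phiM//; last exact: SV.
  by rewrite mulVmx ?SU// hom1 mul1mx.
- by move=> i j t ij; split; [exact: plane_rot_SO|exact: fixv].
Qed.

Lemma plane_rot_continuous (i j : 'I_k) : continuous (@plane_rot R k i j).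
Proof.
move=> t; apply: cvgD; last first.
  by apply: cvgZr_tmp; exact: continuous_sin.
apply: cvgD; first exact: cvg_cst.
by apply: cvgZr_tmp; apply: cvgB; [exact: continuous_cos|exact: cvg_cst].
Qed.

Lemma hom_rot_continuous (i j : 'I_k) (a b : 'I_N) : i != j ->
  continuous (fun t => phi (plane_rot i j t) a b).
Proof.
move=> ij t; have [_ _ /subspace_continuousP cphi] := hphi.
have SR u : special_orthogonal_group R k (plane_rot i j u)
  by exact: plane_rot_SO.
apply: (@cvg_comp _ _ _ (fun t => phi (plane_rot i j t)) (fun M => M a b) _
   (nbhs (phi (plane_rot i j t)))); last exact: coord_continuous.
apply: (@cvg_comp _ _ _ (plane_rot i j) phi _
   (within (special_orthogonal_group R k) (nbhs (plane_rot i j t)))).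
  move=> U; rewrite /within/= => nU.
  have := plane_rot_continuous nU; rewrite /= !nbhs_simpl/=.
  by apply: filterS => u; apply.
exact: cphi.
Qed.

End Representation.

Section Generation.
Variables (R : realType) (k N : nat) (phi : 'M[R]_k -> 'M[R]_N).
Hypothesis hphi : continuous_SO_hom phi.

Lemma permutation_conjugates_SO :
  permutation_conjugates phi `<=` special_orthogonal_group R N.
Proof.
have [phiSO _ _] := hphi; have [_ _ oM oV] := orthogonal_group_subgroup R N.
move=> _ [s [g /phiSO[og dg] ->]]; have oP := perm_mx_orthogonal R s.
split; first by apply/oM/oP/oM/og/oV.
have uP : perm_mx s \in unitmx := unitmx_perm R s.
by rewrite !det_mulmx det_inv dg mulr1 mulVr -?unitmxE.
Qed.

Hypothesis hinv :
  ~ exists L : {vspace 'cV[R]_N}, \dim L = 1%N /\ SO_invariant phi L.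
Hypothesis hN : (2 <= N)%N.

Let H := subgroup_generated (permutation_conjugates phi).

(** The one-parameter group used is the image of a plane rotation group that
    moves the all-ones vector v; that A v is nonzero means that some row of A
    has a nonzero sum, which is what [wedge_approx] needs. *)
Lemma generated_SO : H = special_orthogonal_group R N.
Proof.
have HG : matrix_subgroup H.
  by apply: (subgroup_generated_group (SO_subgroup R N));
    exact: permutation_conjugates_SO.
have HS : H `<=` special_orthogonal_group R N.
  by apply: smallest_sub; [exact: SO_subgroup|exact: permutation_conjugates_SO].
have HO : H `<=` orthogonal_group R N by move=> A /HS[].
apply/seteqP; split=> //.
pose v : 'cV[R]_N := const_mx 1.
have v0 : v != 0.
  apply/eqP => /(congr1 (fun B : 'cV[R]_N => B (Ordinal (ltnW hN)) 0)).
  by rewrite !mxE => /eqP; rewrite oner_eq0.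
have [i [j [ij [t tv]]]] : exists i j : 'I_k, i != j /\
    exists t, phi (plane_rot i j t) *m v <> v.
  apply: contrapT => no; apply: hinv; apply: (fixed_vector_line hphi v0) =>
    i j t ij.
  by apply: contrapT => tv; apply: no; exists i, j; split=> //; exists t.
have [phiSO phiM _] := hphi.
pose h t := phi (plane_rot i j t).
have hD t1 t2 : h (t1 + t2) = h t1 *m h t2.
  by rewrite /h plane_rotD// phiM//; exact: plane_rot_SO.
have h0 : h 0 = 1%:M by rewrite /h plane_rot0 hom1.
have [A hA] := oneparam_generator hD h0 (fun a b => hom_rot_continuous hphi ij).
have ho u : orthogonal_group R N (h u) by apply: (phiSO _ _).1;
  exact: plane_rot_SO.
have sA := oneparam_skew hD h0 hA ho.
have [m rm] : exists m, \sum_l A m l != 0.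
  apply: contrapT => no; apply: tv; apply: (oneparam_fix hD h0 hA).
  apply/colP => m; rewrite !mxE; apply: contrapT => nz; apply: no; exists m.
  apply/eqP => z; apply: nz; rewrite -[RHS]z; apply: eq_bigr => l _.
  by rewrite mxE mulr1.
apply: (subgroup_contains_SO HG HO); apply: (wedge_approx HG HO hN sA rm) => s.
exists (fun u => permuted (h u) s); split.
- move=> u M [_ SM]; apply: SM; exists s^-1%g.
  by exists (plane_rot i j u); [exact: plane_rot_SO|rewrite perm_conjugate].
- by rewrite -perm_conjugate h0 mulmx1 mulVmx// unitmx_perm.
- have hd := oneparam_strict_diff hD h0 hA.
  have bA := bounded_op_scale A.
  apply: strict_diff_ext (strict_diff_mulr (perm_mx s^-1) (strict_diff_mull
    (invmx (perm_mx s^-1)) hd bA)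
     (bounded_op_mull _ bA)) => u.
    exact: perm_conjugate.
  by rewrite -scalemxAr -scalemxAl perm_conjugate.
Qed.

(** SO(N) has index 2 in O(N), and the odd permutation matrix lies in the
    other coset. *)
Lemma generated_O (s0 : 'S_N) : odd_perm s0 ->
  subgroup_generated ([set perm_mx s0 : 'M[R]_N] `|` permutation_conjugates phi)
    = orthogonal_group R N.
Proof.
move=> odd0; set S := _ `|` _.
have SO : S `<=` orthogonal_group R N.
  move=> A [->|/permutation_conjugates_SO[]//]; exact: perm_mx_orthogonal.
have OG := orthogonal_group_subgroup R N.
have KG : matrix_subgroup (subgroup_generated S) :=
  subgroup_generated_group OG SO.
apply/seteqP; split; first exact: smallest_sub.
have [KU K1 KM KV] := KG.
have K0 : subgroup_generated S (perm_mx s0).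
  by move=> M [_ SM]; apply: SM; left.
have SK : special_orthogonal_group R N `<=` subgroup_generated S.
  rewrite -generated_SO; apply: smallest_sub => // A hA M [_ SM].
  by apply: SM; right.
move=> M oM; have := det_orthogonal oM => /eqP;
  rewrite sqrf_eq1 => /orP[/eqP dM|/eqP dM].
  by apply: SK; split.
have uP : perm_mx s0 \in unitmx := unitmx_perm R s0.
rewrite -(mulmxK uP M); apply: KM; last exact: KV.
apply: SK; split; first by have [_ _ oMul _] := OG;
  apply/oMul/perm_mx_orthogonal.
by rewrite det_mulmx dM det_perm odd0 expr1 mulrNN mulr1.
Qed.

End Generation.

Theorem theorem2p1 (R : realType) (k N : nat) (hk : (3 <= k)%N) (hN : (3 <= N)%N)
    (phi : 'M[R]_k -> 'M[R]_N) (hphi : continuous_SO_hom phi)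
    (hinv : ~ exists L : {vspace 'cV[R]_N}, \dim L = 1%N /\ SO_invariant phi L) :
  subgroup_generated (permutation_conjugates phi)
    = special_orthogonal_group R N
  /\ (forall s0 : 'S_N, odd_perm s0 ->
        subgroup_generated
          ([set perm_mx s0 : 'M[R]_N] `|` permutation_conjugates phi)
        = orthogonal_group R N).
Proof.
have hN2 := ltnW hN; split; first exact: generated_SO.
by move=> s0; exact: generated_O.
Qed.
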